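(* Let $G$ be a finite simple graph with minimum degree $\delta=\delta(G)\ge 2$ and maximum degree $\Delta=\Delta(G)$. Then $$\chi_2(G)-\chi(G)\le \left\lceil \sqrt[\delta-1]{4\Delta^2}\right\rceil\left(\left\lfloor \log_{\frac{2\Delta(G)}{2\Delta(G)-\delta(G)}} \alpha(G)\right\rfloor+1\right)+1.$$
   Context: $\chi(G)$ is the chromatic number and $\alpha(G)$ the independence number of $G$. A dynamic coloring of $G$ is a proper vertex coloring such that for every vertex $v$ of degree at least $2$, the neighbours of $v$ receive at least two different colors; $\chi_2(G)$, the dynamic chromatic number, is the smallest number of colors in a dynamic coloring of $G$. The paper writes $\log_b \alpha(G)$ as $\log^{\alpha(G)}_{b}$. *)

(* Defs.v *)
From HB Require Import structures.
From mathcomp Require Import all_boot all_order all_algebra.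
From mathcomp Require Import reals exp.

Set Implicit Arguments.
Unset Strict Implicit.
Unset Printing Implicit Defensive.

Record sgraph := SGraph {
  vertex :> finType;
  adj : rel vertex;
  adj_sym : symmetric adj;
  adj_irrefl : irreflexive adj
}.

Section GraphParameters.
Variable G : sgraph.
Implicit Type v : G.

Definition neighbours v : {set G} := [set u | adj v u].

Definition degree v : nat := #|neighbours v|.

Definition max_degree : nat := \max_(v : G) degree v.

(* Every degree is less than #|G|, so the initial value #|G| never matters when
   G has a vertex; on the graph without vertices min_degree is 0. *)
Definition min_degree : nat := \big[minn/#|G|]_(v : G) degree v.

Definition independent (S : {set G}) : bool :=
  [forall u in S, forall v in S, ~~ adj u v].

Definition independence_number : nat :=
  \max_(S : {set G} | independent S) #|S|.

Definition proper_coloring k (f : {ffun G -> 'I_k}) : bool :=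
  [forall u, forall v, adj u v ==> (f u != f v)].

Definition dynamic_coloring k (f : {ffun G -> 'I_k}) : bool :=
  proper_coloring f &&
  [forall v, (2 <= degree v) ==> (2 <= #|[set f u | u in neighbours v]|)].

Definition colorable k : bool :=
  [exists f : {ffun G -> 'I_k}, proper_coloring f].

Definition dynamic_colorable k : bool :=
  [exists f : {ffun G -> 'I_k}, dynamic_coloring f].

Lemma dynamic_colorable_card : dynamic_colorable #|G|.
Proof.
apply/existsP; exists [ffun v => enum_rank v]; apply/andP; split.
  apply/'forall_forallP => u v; apply/implyP => uv; rewrite !ffunE.
  by apply: contraTneq uv => /enum_rank_inj ->; rewrite adj_irrefl.
apply/forallP => v; apply/implyP => dv.
by rewrite card_imset // => x y; rewrite !ffunE => /enum_rank_inj.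
Qed.

Lemma exists_colorable : exists k, colorable k.
Proof.
exists #|G|; have /existsP[f /andP[pf _]] := dynamic_colorable_card.
by apply/existsP; exists f.
Qed.

Lemma exists_dynamic_colorable : exists k, dynamic_colorable k.
Proof. by exists #|G|; apply: dynamic_colorable_card. Qed.

Definition chromatic_number : nat := ex_minn exists_colorable.

Definition dynamic_chromatic_number : nat := ex_minn exists_dynamic_colorable.

End GraphParameters.

Section RealFunctions.
Local Open Scope ring_scope.
Variable R : realType.

(* The usual root for 0 < n and 0 <= x only: powR and ln take default values on
   negative arguments. *)
Definition nth_root (n : nat) (x : R) : R := x `^ (n%:R)^-1.

Definition log_base (b x : R) : R := ln x / ln b.

End RealFunctions.

(* Main.v *)
(** Let [r] and [L] be the ceiling and the floor in the bound.  By the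
    Lovász local lemma, in counting form, the vertices have an [r]-coloring [g]
    that is constant on no neighbourhood.  Take a maximal independent set [M].
    Greedily choose independent sets [T_1, ..., T_L], each meeting the
    neighbourhoods of at least a fraction [delta / (2 Delta)] of the vertices of
    [M] not reached before; as [2 Delta / (2 Delta - delta) <= 2], at most one
    vertex of [M] is left, and [w0] is one of its neighbours.  In an optimal
    proper coloring, recolor each vertex [u] of [M], [T_1, ..., T_L] by the pair
    (first set containing [u], [g u]), and [w0] by one further color.  Every
    vertex then has a recolored neighbour, and its neighbourhood cannot be
    monochromatic: [g] splits it if it lies in one set. *)
Require Import Defs.
From HB Require Import structures.
From mathcomp Require Import all_boot all_order all_algebra.
From mathcomp Require Import reals exp.
From mathcomp Require Import zify lra.

Set Implicit Arguments.
Unset Strict Implicit.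
Unset Printing Implicit Defensive.

Import Order.TTheory GRing.Theory Num.Theory.
Local Open Scope ring_scope.

(** * The local lemma for monochromatic hyperedges, by counting *)

Section HypergraphColoring.
Local Open Scope nat_scope.
Variables (T I : finType) (E : I -> {set T}) (r : nat).
Hypothesis r_gt0 : 0 < r.
Implicit Types (f g : {ffun T -> 'I_r}) (S : {set I}) (i j : I).

Definition mono i f : bool := [forall x in E i, forall y in E i, f x == f y].

Definition good S : {set {ffun T -> 'I_r}} :=
  [set f | [forall i in S, ~~ mono i f]].

Lemma eq_mono i f g : {in E i, f =1 g} -> mono i f = mono i g.
Proof.
move=> fg; apply: eq_forallb => x; case: (boolP (x \in E i)) => //= xE.
apply: eq_forallb => y; case: (boolP (y \in E i)) => //= yE.
by rewrite !fg.
Qed.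

(* A coloring satisfying [Q] that is constant on [A] can be changed freely on
   all points of [A] but one; this is the independence used in the local lemma. *)
Lemma card_const_indep (A : {set T}) (Q : pred {ffun T -> 'I_r}) :
    (forall f g, {in ~: A, f =1 g} -> Q f = Q g) ->
  #|[set f | Q f && [forall x in A, forall y in A, f x == f y]]| * r ^ #|A|.-1
    <= #|[set f | Q f]|.
Proof.
move=> Qext; have [->|[x0 x0A]] := set_0Vmem A.
  by rewrite cards0 muln1 subset_leq_card //; apply/subsetP => f; rewrite !inE => /andP[].
set B := [set f | _]; pose y0 := Ordinal r_gt0.
have -> : #|A|.-1 = #|A :\ x0| by rewrite (cardsD1 x0 A) x0A.
pose H : {set {ffun T -> 'I_r}} := [set h in pffun_on y0 (A :\ x0) 'I_r].
have <- : #|H| = r ^ #|A :\ x0| by rewrite cardsE card_pffun_on card_ord.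
rewrite -cardsX.
(* [F] overwrites [p.1] by [p.2] on [A :\ x0]. On the pairs in question it is injective: the
   constant value of [p.1] on [A] is still visible at [x0], and [p.2] has the default value [y0] off
   [A :\ x0]. *)
pose F (p : {ffun T -> 'I_r} * {ffun T -> 'I_r}) : {ffun T -> 'I_r} :=
  [ffun x => if x \in A :\ x0 then p.2 x else p.1 x].
rewrite -(@card_in_imset _ _ F); first (apply: subset_leq_card; apply/subsetP => f).
  case/imsetP => -[f1 f2]; rewrite !inE /= => /andP[/andP[Qf1 _] _] ->.
  rewrite (Qext _ f1) // => x; rewrite !inE ffunE !inE => /negbTE xA.
  by rewrite xA andbF.
move=> [f1 f2] [g1 g2]; rewrite !inE /=.
move=> /andP[/andP[_ /'forall_in_'forall_in_eqP f1c] /pffun_onP[/subsetP f2s _]].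
move=> /andP[/andP[_ /'forall_in_'forall_in_eqP g1c] /pffun_onP[/subsetP g2s _]].
move=> /ffunP FF; congr (_, _); apply/ffunP => x.
  have f1x0 : f1 x0 = g1 x0 by have := FF x0; rewrite !ffunE !inE eqxx.
  have := FF x; rewrite !ffunE !inE.
  case: (boolP (x \in A)) => [xA _|_]; last by rewrite andbF.
  by rewrite (f1c x xA x0 x0A) (g1c x xA x0 x0A).
have := FF x; rewrite !ffunE; case: ifP => // /negbT xA _.
have := contraNN (f2s x) xA; have := contraNN (g2s x) xA.
by rewrite !inE !negbK => /eqP-> /eqP->.
Qed.

Variables (k D : nat).
Hypothesis k_gt0 : 0 < k.
Hypothesis cardE : forall i, k <= #|E i|.
Hypothesis degE : forall i, #|[set j | ~~ [disjoint E i & E j]]| <= D.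
Hypothesis rkD : 4 * D <= r ^ k.-1.

Let D_gt0 i : 0 < D.
Proof.
apply: leq_trans (degE i); apply/card_gt0P; exists i; rewrite inE.
by rewrite -setI_eq0 setIid -card_gt0 (leq_trans k_gt0).
Qed.

Lemma mono_good_far i S : (forall j, j \in S -> [disjoint E i & E j]) ->
  #|[set f in good S | mono i f]| * (4 * D) <= #|good S|.
Proof.
move=> Sfar; apply: (@leq_trans (#|[set f in good S | mono i f]| * r ^ #|E i|.-1)).
  rewrite leq_mul2l (leq_trans rkD) ?orbT // leq_pexp2l //.
  by have := cardE i; lia.
rewrite -[leqRHS]cardsE; apply: card_const_indep => f g fg.
rewrite !inE; apply: eq_forallb => j.
case: (boolP (j \in S)) => //= jS; congr (~~ _); apply: eq_mono => x xj.
apply: fg; rewrite inE; apply/negP => xi.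
by have /disjointFr/(_ xi) := Sfar j jS; rewrite xj.
Qed.

(** The induction of the local lemma. Given only the edges [S2] disjoint from [E i], a fraction at
    most [1 / (4 * D)] is constant on [E i]. By induction each of the at most [D] edges in [S1] is
    constant on at most [1 / (2 * D)] of [good S2], so restoring them keeps at least half of it. *)
Lemma mono_good S i : #|[set f in good S | mono i f]| * (2 * D) <= #|good S|.
Proof.
have [n] := ubnP #|S|; elim: n S i => // n IHn S i ltSn.
pose S1 := [set j in S | ~~ [disjoint E i & E j]]; pose S2 := S :\: S1.
have sS2 : S2 \subset S by apply: subsetDl.
have sgood : good S \subset good S2.
  apply/subsetP => f; rewrite !inE => /forall_inP fS; apply/forall_inP => j jS2.
  by apply: fS; apply: subsetP jS2.
have far : #|[set f in good S2 | mono i f]| * (4 * D) <= #|good S2|.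
  apply: mono_good_far => j; rewrite !inE => /andP[+ jS].
  by rewrite jS negbK.
have near : #|good S2| <= 2 * #|good S|.
  (* The induction hypothesis needs [S2] strictly smaller than [S], so an empty [S1] is treated
     apart. *)
  have [S10|[j0 j0S1]] := set_0Vmem S1.
    by rewrite /S2 S10 setD0 leq_pmull.
  have ltS2 : #|S2| < n.
    apply: leq_trans (_ : #|S2| < #|S|) ltSn; apply: proper_card.
    rewrite properE sS2 /=; apply/subsetPn; exists j0; last by rewrite in_setD j0S1.
    by move: j0S1; rewrite inE => /andP[].
  have cover : good S2 \subset good S :|: \bigcup_(j in S1) [set f in good S2 | mono j f].
    apply/subsetP => f fS2; rewrite inE; case: (boolP (f \in good S)) => //= fS.
    move: fS; rewrite inE => /forall_inPn[j jS]; rewrite negbK => mj.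
    apply/bigcupP; exists j; last by rewrite inE fS2.
    by apply: contraTT mj => jS1; move: fS2; rewrite inE => /forall_inP; apply; rewrite in_setD jS1.
  have := leq_trans (subset_leq_card cover) (leq_card_setU _ _).
  set U := \bigcup_(j in _) _ => le1.
  have : #|U| * (2 * D) <= #|good S2| * D.
    apply: (@leq_trans ((\sum_(j in S1) #|[set f in good S2 | mono j f]|) * (2 * D))).
      rewrite leq_mul2r; apply/orP; right; rewrite /U.
      elim/big_rec2: _ => [|j m A _ IH]; first by rewrite cards0.
      by apply: leq_trans (leq_card_setU _ _) _; rewrite leq_add2l.
    rewrite big_distrl /=; apply: (@leq_trans (\sum_(j in S1) #|good S2|)).
      by apply: leq_sum => j _; apply: IHn.
    rewrite sum_nat_const mulnC leq_mul2l; apply/orP; right.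
    apply: leq_trans (degE i); apply: subset_leq_card; apply/subsetP => j.
    by rewrite !inE => /andP[].
  rewrite mulnA leq_pmul2r ?(D_gt0 i) //; lia.
have : #|[set f in good S | mono i f]| <= #|[set f in good S2 | mono i f]|.
  apply: subset_leq_card; apply/subsetP => f; rewrite !in_set.
  by move=> /andP[fS ->]; rewrite andbT; have := subsetP sgood f; rewrite !in_set; apply.
move: far near; nia.
Qed.

(** Edges are added one at a time; by [mono_good] each destroys at most half of the good colorings
    left. *)
Lemma good_neq0 S : 0 < #|good S|.
Proof.
have [n] := ubnP #|S|; elim: n S => // n IHn S ltSn.
have [->|[i iS]] := set_0Vmem S.
  apply/card_gt0P; exists [ffun=> Ordinal r_gt0]; rewrite inE.
  by apply/forall_inP => i; rewrite inE.
have {}/IHn : #|S :\ i| < n by move: ltSn; rewrite (cardsD1 i) iS.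
have cover : good (S :\ i) \subset good S :|: [set f in good (S :\ i) | mono i f].
  apply/subsetP => f fS2; rewrite inE; case: (boolP (f \in good S)) => //= fS.
  move: fS; rewrite inE => /forall_inPn[j jS]; rewrite negbK => mj.
  rewrite inE fS2 /=; have [<- //|ji] := eqVneq j i.
  by move: fS2; rewrite inE => /forall_inP/(_ j); rewrite !inE ji jS mj => /(_ isT).
have := leq_trans (subset_leq_card cover) (leq_card_setU _ _).
have := mono_good (S :\ i) i; have := D_gt0 i; nia.
Qed.

Lemma hypergraph_coloring :
  exists g : T -> 'I_r, forall i, exists x y, [/\ x \in E i, y \in E i & g x != g y].
Proof.
have /card_gt0P[g] := good_neq0 [set: I].
rewrite inE => /forall_inP gP; exists g => i.
have /forall_inPn[x xE /forall_inPn[y yE gxy]] := gP i (in_setT i).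
by exists x, y.
Qed.

End HypergraphColoring.

(** * Covering by independent sets *)

Section GraphCovering.
Local Open Scope nat_scope.
Variable G : sgraph.
Implicit Types (u v w : G) (M W T : {set G}).

Lemma degree_le_max v : degree v <= max_degree G.
Proof. exact: leq_bigmax. Qed.

Lemma min_degree_le v : min_degree G <= degree v.
Proof.
rewrite /min_degree; elim: index_enum (mem_index_enum v) => //= w s IH.
rewrite inE big_cons => /predU1P[<-|/IH]; first exact: geq_minl.
by move=> le; apply: leq_trans le; apply: geq_minr.
Qed.

Lemma min_degree_gt0 : 0 < min_degree G -> 0 < #|G|.
Proof.
move=> d0; apply: leq_trans d0 _; rewrite /min_degree.
by elim/big_rec: _ => // v m _; apply: leq_trans (geq_minr _ _).
Qed.

Definition covers T v : bool := [exists u in T, adj v u].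

Lemma coversP T v : reflect (exists2 u, u \in T & adj v u) (covers T v).
Proof. exact: exists_inP. Qed.

Lemma sum_adj W v : \sum_(w in W) adj v w = #|neighbours v :&: W|.
Proof.
rewrite -sum1_card big_mkcond [RHS]big_mkcond; apply: eq_bigr => w _.
by rewrite !inE; case: (w \in W); case: (adj v w).
Qed.

(** Ordered pairs are counted, so an edge inside [M :&: W] counts twice. *)
Definition edges M W := \sum_(v in M) \sum_(w in W) adj v w.

Lemma edgesC M W : edges M W = edges W M.
Proof.
rewrite /edges exchange_big; apply: eq_bigr => w _; apply: eq_bigr => v _.
by rewrite adj_sym.
Qed.

Lemma edges_split M W U : edges M W = edges (M :&: U) W + edges (M :\: U) W.
Proof. by rewrite /edges (big_setID U). Qed.

Lemma edges_le M W d :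
  {in M, forall v, #|neighbours v :&: W| <= d} -> edges M W <= #|M| * d.
Proof. by move=> le; rewrite -sum_nat_const leq_sum // => v vM; rewrite sum_adj le. Qed.

(* Greedy choice: adding a vertex [u] of [W] with [d] neighbours in [M], [d]
   maximal, covers [d] new vertices and destroys at most [2 * d * Delta] edges
   (those at neighbours of [u] in [M], and those at neighbours of [u] in [W]). *)
Lemma greedy_cover M W : exists2 T, independent T /\ T \subset W &
  edges M W <= 2 * max_degree G * #|[set v in M | covers T v]|.
Proof.
have [n] := ubnP #|W|; elim: n M W => // n IHn M W ltWn.
case: (set_0Vmem W) => [->|[w wW]].
  exists set0; last by rewrite edgesC /edges big_set0.
  by rewrite sub0set; split=> //; apply/forall_inP => u; rewrite inE.
case: (@arg_maxnP _ w [in W] (fun v => #|neighbours v :&: M|) wW) => u uW umax.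
set d := #|neighbours u :&: M|.
pose M1 := M :\: neighbours u; pose W1 := W :\: (u |: neighbours u).
have ltW1 : #|W1| < n.
  apply: leq_trans (_ : #|W| <= n) => //; apply: proper_card.
  rewrite properE subsetDl /=; apply/subsetPn; exists u => //.
  by rewrite !inE eqxx.
have [T [Tind TW1] Tcov] := IHn M1 W1 ltW1.
have Tu v : v \in T -> (v != u) && ~~ adj u v.
  by move=> /(subsetP TW1); rewrite !inE negb_or => /andP[].
exists (u |: T).
  split; last first.
    by rewrite subUset sub1set uW (subset_trans TW1) ?subsetDl.
  apply/forall_inP => x xT; apply/forall_inP => y yT.
  move: xT yT; rewrite !inE => /predU1P[->|xT] /predU1P[->|yT].
  - by rewrite adj_irrefl.
  - by case/andP: (Tu _ yT).
  - by rewrite adj_sym; case/andP: (Tu _ xT).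
  - by move/forall_inP/(_ _ xT)/forall_inP/(_ _ yT): Tind.
have cardcov : d + #|[set v in M1 | covers T v]| <= #|[set v in M | covers (u |: T) v]|.
  rewrite /d setIC -(cardsID (neighbours u) [set v in M | _]) leq_add //.
    apply: subset_leq_card; apply/subsetP => v; rewrite !inE => /andP[vM uv].
    by rewrite vM uv /= andbT; apply/coversP; exists u; rewrite ?setU11 // adj_sym.
  apply: subset_leq_card; apply/subsetP => v; rewrite !inE.
  case/andP => /andP[-> ->] /coversP[x xT vx] /=.
  by apply/coversP; exists x; rewrite // inE xT orbT.
have e1 : edges (M :&: neighbours u) W <= d * max_degree G.
  rewrite /d setIC; apply: edges_le => v _.
  by apply: leq_trans (degree_le_max v); rewrite subset_leq_card ?subsetIl.
have e2 : edges (W :&: (u |: neighbours u)) M1 <= max_degree G * d.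
  (* [u] has no neighbour in [M1]. Setting it apart leaves at most [max_degree G] vertices rather
     than one more, each with at most [d] neighbours in [M] by the choice of [u]. *)
  rewrite (edges_split _ _ [set u]).
  have -> : edges (W :&: (u |: neighbours u) :&: [set u]) M1 = 0.
    apply/eqP; rewrite -leqn0 -(muln0 #|W :&: (u |: neighbours u) :&: [set u]|).
    apply: edges_le => v; rewrite in_setI => /andP[_ /set1P->].
    by rewrite leqn0 cards_eq0 -subset0; apply/subsetP => x; rewrite !inE; case: (adj u x).
  rewrite add0n; apply: (@leq_trans (#|W :&: (u |: neighbours u) :\: [set u]| * d)).
    apply: edges_le => v; rewrite !inE => /andP[_ /andP[vW _]].
    apply: leq_trans (umax v vW).
    by rewrite subset_leq_card // setIS // subsetDl.
  rewrite leq_mul2r; apply/orP; right; apply: leq_trans (degree_le_max u).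
  apply: subset_leq_card; apply/subsetP => x; rewrite !inE.
  by case: eqP => //= _ /andP[].
rewrite (edges_split M W (neighbours u)) -/M1 (edgesC M1) (edges_split W M1 (u |: neighbours u)).
rewrite -/W1 (edgesC W1).
move: e1 e2 Tcov cardcov; nia.
Qed.

Definition uncovered M (s : seq {set G}) := [set v in M | ~~ has (covers^~ v) s].

(** Each round is a greedy choice with [W] the whole graph: every vertex of [M] then contributes at
    least [min_degree G] pairs, so a fraction at least [min_degree G / (2 * max_degree G)] of [M] is
    covered. The next round treats the rest. *)
Lemma iterated_cover M L : exists s : seq {set G},
  [/\ size s = L, all (@independent G) s &
   #|uncovered M s| * (2 * max_degree G) ^ L <=
     #|M| * (2 * max_degree G - min_degree G) ^ L].
Proof.
elim: L M => [|L IHL] M.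
  exists [::]; split => //; rewrite !muln1 subset_leq_card //.
  by apply/subsetP => v; rewrite inE => /andP[].
have [T [Tind _] Tcov] := greedy_cover M setT.
have [s [ss sind scard]] := IHL [set v in M | ~~ covers T v].
exists (T :: s); rewrite /= ss Tind sind; split => //.
have -> : uncovered M (T :: s) = uncovered [set v in M | ~~ covers T v] s.
  by apply/setP => v; rewrite !inE /= negb_or andbA.
have cardM : #|M| = #|[set v in M | covers T v]| + #|[set v in M | ~~ covers T v]|.
  rewrite -(cardsID [set v | covers T v] M); congr (_ + _).
    by apply: eq_card => v; rewrite !inE.
  by apply: eq_card => v; rewrite !inE andbC.
have edgesM : #|M| * min_degree G <= edges M setT.
  rewrite -sum_nat_const leq_sum // => v _; rewrite sum_adj setIT.
  exact: min_degree_le.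
have step : #|[set v in M | ~~ covers T v]| * (2 * max_degree G)
    <= #|M| * (2 * max_degree G - min_degree G).
  by rewrite mulnBr; move: edgesM Tcov; nia.
rewrite !expnS [in leqLHS]mulnCA [in leqRHS]mulnA.
apply: (@leq_trans (2 * max_degree G * (#|[set v in M | ~~ covers T v]| *
   (2 * max_degree G - min_degree G) ^ L))).
  by rewrite leq_mul2l scard orbT.
by rewrite mulnA leq_mul2r [2 * _ * _]mulnC step orbT.
Qed.

(** * Construction of the dynamic coloring *)

Lemma dynamic_colorable_fin (C : finType) (F : G -> C) :
    (forall u v, adj u v -> F u != F v) ->
    (forall v, exists x y, [/\ adj v x, adj v y & F x != F y]) ->
  dynamic_colorable G #|C|.
Proof.
move=> Fproper Fdyn; apply/existsP; exists [ffun v => enum_rank (F v)].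
apply/andP; split.
  apply/'forall_forallP => u v; apply/implyP => /Fproper; rewrite !ffunE.
  by apply: contraNneq => /enum_rank_inj ->.
apply/forallP => v; apply/implyP => _; have [x [y [vx vy Fxy]]] := Fdyn v.
apply/card_gt1P; exists (enum_rank (F x)), (enum_rank (F y)); split.
- by apply/imsetP; exists x; rewrite ?inE ?ffunE.
- by apply/imsetP; exists y; rewrite ?inE ?ffunE.
- by apply: contraNneq Fxy => /enum_rank_inj ->.
Qed.

Lemma dynamic_colorable_min k : dynamic_colorable G k -> dynamic_chromatic_number G <= k.
Proof. by rewrite /dynamic_chromatic_number; case: ex_minnP => m _; apply. Qed.

Lemma colorable_chromatic :
  exists c : G -> 'I_(chromatic_number G), forall u v, adj u v -> c u != c v.
Proof.
rewrite /chromatic_number; case: ex_minnP => m /existsP[f fP] _; exists f => u v uv.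
by move/'forall_forallP/(_ u v)/implyP: fP; apply.
Qed.

(** The local lemma for the hypergraph of neighbourhoods, with [D] the square of the maximum degree:
    a neighbourhood meeting that of [v] belongs to the end of a walk of length two from [v]. *)
Lemma neighbourhood_coloring r : 2 <= min_degree G ->
    4 * max_degree G ^ 2 <= r ^ (min_degree G).-1 -> 0 < r ->
  exists g : G -> 'I_r, forall v, exists x y, [/\ adj v x, adj v y & g x != g y].
Proof.
move=> d2 le r0.
have deg v : #|[set w | ~~ [disjoint neighbours v & neighbours w]]| <= max_degree G ^ 2.
  apply: (@leq_trans #|\bigcup_(u in neighbours v) neighbours u|).
    apply: subset_leq_card; apply/subsetP => w; rewrite inE => /pred0Pn[u] /=.
    rewrite !inE => /andP[vu wu]; apply/bigcupP; exists u; rewrite inE //.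
    by rewrite adj_sym.
  apply: (@leq_trans (\sum_(u in neighbours v) max_degree G)).
    elim/big_rec2: _ => [|u m A _ IH]; first by rewrite cards0.
    by apply: leq_trans (leq_card_setU _ _) _; rewrite leq_add ?degree_le_max.
  by rewrite sum_nat_const -mulnn leq_mul2r degree_le_max orbT.
have [g gP] := hypergraph_coloring r0 (ltnW d2) (@min_degree_le) deg le.
by exists g => v; have [x [y []]] := gP v; rewrite !inE => *; exists x, y.
Qed.

Lemma maximal_independent : exists2 M : {set G}, independent M &
  forall v, v \notin M -> covers M v.
Proof.
have ind0 : independent (set0 : {set G}) by apply/forall_inP => u; rewrite inE.
have [M /maxsetP[Mind Mmax] _] := maxset_exists ind0.
exists M => // v vM; apply: contraNT vM => /existsPn vN.
suff <- : v |: M = M by rewrite setU11.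
apply: Mmax (subsetUr _ _); apply/forall_inP => x xM; apply/forall_inP => y yM.
have N z : z \in M -> ~~ adj v z by move=> zM; have := vN z; rewrite zM.
move: xM yM; rewrite !inE => /predU1P[->|xM] /predU1P[->|yM].
- by rewrite adj_irrefl.
- exact: N.
- by rewrite adj_sym N.
- by move/forall_inP/(_ _ xM)/forall_inP/(_ _ yM): Mind.
Qed.

Lemma dynamic_chromatic_bound r L : 2 <= min_degree G ->
    4 * max_degree G ^ 2 <= r ^ (min_degree G).-1 ->
    independence_number G * (2 * max_degree G - min_degree G) ^ L.+1
      < (2 * max_degree G) ^ L.+1 ->
  dynamic_chromatic_number G <= (chromatic_number G + L.+1 * r).+1.
Proof.
move=> d2 ler ltL; have [c cP] := colorable_chromatic.
have /card_gt0P[v0 _] := min_degree_gt0 (ltnW d2).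
have Dd : min_degree G <= max_degree G.
  exact: leq_trans (min_degree_le v0) (degree_le_max v0).
have r0 : 0 < r.
  by case: r ler => //; rewrite exp0n; move: d2 Dd; nia.
have [g gP] := neighbourhood_coloring d2 ler r0.
have [M Mind Mmax] := maximal_independent.
have [s [ss sind scard]] := iterated_cover M L.
have Malpha : #|M| <= independence_number G by exact: leq_bigmax_cond.
(* Only [L] rounds are made. The remaining factor of [ltL] gives the strict inequality below, and
   two uncovered vertices would contradict it because the minimum degree is at most the maximum
   degree. *)
have unc1 : #|uncovered M s| <= 1.
  rewrite leqNgt; apply/negP => unc2.
  have p0 : 0 < (2 * max_degree G) ^ L by rewrite expn_gt0; move: d2 Dd; nia.
  have : #|uncovered M s| * (2 * max_degree G - min_degree G) < 2 * max_degree G.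
    rewrite -(ltn_pmul2r p0) -[ltnRHS]expnS (leq_ltn_trans _ ltL) // mulnAC.
    rewrite expnS mulnCA mulnC leq_mul2l (leq_trans scard) ?orbT //.
    by rewrite leq_mul2r Malpha orbT.
  by move: unc2 d2 Dd; nia.
have [w0 w0P] : exists w0, forall v, v \in uncovered M s -> adj v w0.
  have [->|[v vU]] := set_0Vmem (uncovered M s); first by exists v0 => v; rewrite inE.
  have [x [_ [vx _ _]]] := gP v; exists x => w wU.
  by have -> : w = v by apply: (card_le1_eqP unc1).
(* [find] returns the length [L.+1] on vertices in none of the sets. The first index makes the color
   well defined when sets overlap; [w0] keeps its pair if it lies in one of them. *)
pose lev u := find (fun T : {set G} => u \in T) (M :: s).
have sizeMs : size (M :: s) = L.+1 by rewrite /= ss.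
pose F u : option ('I_(chromatic_number G) + 'I_L.+1 * 'I_r) :=
  if lev u < L.+1 then Some (inr (inord (lev u), g u))
  else if u == w0 then None else Some (inl (c u)).
have -> : (chromatic_number G + L.+1 * r).+1 =
    #|{: option ('I_(chromatic_number G) + 'I_L.+1 * 'I_r)}|.
  by rewrite card_option card_sum card_prod !card_ord.
apply: dynamic_colorable_min; apply: (@dynamic_colorable_fin _ F).
  move=> u v uv; rewrite /F; case: (boolP (lev u < L.+1)) => lu; case: (boolP (lev v < L.+1)) => lv.
  - apply: contraTneq uv => -[/(congr1 val)]; rewrite /= !inordK // => eqlev _.
    have allind : all (@independent G) (M :: s) by rewrite /= Mind.
    have /(all_nthP set0)/(_ (lev u)) := allind; rewrite sizeMs => /(_ lu).
    move=> /forall_inP/(_ u) /(_ _)/forall_inP; apply.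
      by apply: (@nth_find _ set0 (fun T : {set G} => u \in T)); rewrite has_find sizeMs.
    rewrite eqlev.
    by apply: (@nth_find _ set0 (fun T : {set G} => v \in T)); rewrite has_find sizeMs.
  - by case: ifP.
  - by case: ifP.
  case: (eqVneq u w0) => [uw|_]; case: (eqVneq v w0) => [vw|_] //.
    by move: uv; rewrite uw vw adj_irrefl.
  by apply: contraTneq (cP _ _ uv) => -[->]; rewrite eqxx.
move=> v; have [x [y [vx vy gxy]]] := gP v.
(* [z] has a pair or [None] as its color. If [F x = F y], this common color is neither a pair, since
   [g x != g y], nor [None], which only [w0] can have; so [z] differs from [x]. *)
have [z vz zP] : exists2 z, adj v z & (lev z < L.+1) || (z == w0).
  have [vM|/Mmax/coversP[z zM vz]] := boolP (v \in M); last first.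
    by exists z; rewrite // /lev /= zM.
  have [/w0P|] := boolP (v \in uncovered M s); first by exists w0; rewrite ?eqxx ?orbT.
  rewrite inE vM negbK => /hasP[T Ts /coversP[z zT vz]]; exists z => //.
  rewrite -sizeMs -has_find; apply/orP; left; apply/hasP.
  by exists T; rewrite // inE Ts orbT.
have [Fxy|] := eqVneq (F x) (F y); last by exists x, y.
exists z, x; split=> //; apply/eqP => Fzx; move: Fzx zP Fxy; rewrite /F.
case: (boolP (lev x < L.+1)) => _.
  by move=> _ _; case: ifP => _; [case=> _ gE; rewrite gE eqxx in gxy | case: ifP].
case: (boolP (lev z < L.+1)) => _ /=; first by case: ifP.
move=> Fzx zw; move: Fzx; rewrite zw; case: (eqVneq x w0) => // xw _.
case: ifP => // _; case: (eqVneq y w0) => // yw _.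
by rewrite xw yw eqxx in gxy.
Qed.

End GraphCovering.

(** * From the real root and logarithm to natural numbers *)

Theorem theorem3 (R : realType) (G : sgraph) (delta Delta : nat)
  (hdelta : delta = min_degree G) (hDelta : Delta = max_degree G)
  (hdelta2 : (2 <= delta)%N) :
  (dynamic_chromatic_number G)%:Z - (chromatic_number G)%:Z <=
    Num.ceil (nth_root (delta - 1) (4 * Delta%:R ^+ 2 : R)) *
      (Num.floor (log_base (2 * Delta%:R / (2 * Delta%:R - delta%:R) : R)
                           (independence_number G)%:R) + 1) + 1.
Proof.
have /card_gt0P[v0 _] := min_degree_gt0 (leq_trans (ltnW hdelta2) (eq_leq hdelta)).
have Dd : (delta <= Delta)%N.
  by rewrite hdelta hDelta (leq_trans (min_degree_le v0)) ?degree_le_max.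
have alpha_gt0 : (0 < independence_number G)%N.
  apply: leq_trans (_ : #|[set v0]| <= _)%N; first by rewrite cards1.
  apply: leq_bigmax_cond; apply/forall_inP => x /set1P->.
  by apply/forall_inP => y /set1P->; rewrite adj_irrefl.
set rt := nth_root _ _; set b : R := _ / _; set lg := log_base _ _.
have dR : (2%:R : R) <= delta%:R by rewrite ler_nat.
have DR : (delta%:R : R) <= Delta%:R by rewrite ler_nat.
have den_gt0 : 0 < 2 * Delta%:R - delta%:R :> R by lra.
have b_gt1 : 1 < b by rewrite ltr_pdivlMr //; lra.
have lnb_gt0 : 0 < ln b by rewrite ln_gt0.
(* This uses [alpha_gt0], and makes the floor a natural number [L]. *)
have lg_ge0 : 0 <= lg.
  by rewrite divr_ge0 ?(ltW lnb_gt0) // ln_ge0 // ler1n.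
have rt_ge0 : 0 <= rt by apply: powR_ge0.
have ceil_ge0 : 0 <= Num.ceil rt by rewrite -(ler_int R) (le_trans rt_ge0) ?ceil_ge.
have floor_ge0 : 0 <= Num.floor lg by rewrite floor_ge0.
case Er: (Num.ceil rt) ceil_ge0 => [r|//] _.
case EL: (Num.floor lg) floor_ge0 => [L|//] _.
have rpow : (4 * max_degree G ^ 2 <= r ^ (min_degree G).-1)%N.
  rewrite -hdelta -hDelta -(ler_nat R) natrM !natrX.
  have le_rt : rt <= r%:R by have := ceil_ge rt; rewrite Er.
  have -> : 4 * Delta%:R ^+ 2 = rt ^+ delta.-1 :> R.
    rewrite -[RHS]powR_mulrn // /rt /nth_root -powRrM subn1 mulVf.
      by rewrite powRr1 // mulr_ge0 ?exprn_ge0 ?ler0n.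
    by rewrite pnatr_eq0; lia.
  by rewrite lerXn2r // nnegrE ?ler0n.
have Llt : (independence_number G * (2 * max_degree G - min_degree G) ^ L.+1
      < (2 * max_degree G) ^ L.+1)%N.
  (* Truncated subtraction is exact here as [delta <= Delta]. Dividing and taking logarithms turns
     the goal into [lg < L + 1], the defining property of the floor. *)
  rewrite -hdelta -hDelta -(ltr_nat R) natrM !natrX natrB; last by lia.
  rewrite natrM -ltr_pdivlMr ?exprn_gt0 // -expr_div_n -/b.
  rewrite -ltr_ln ?posrE ?exprn_gt0 ?ltr0n ?(lt_trans ltr01 b_gt1) //.
  rewrite lnXn ?(lt_trans ltr01 b_gt1) // -[ltRHS]mulr_natl -ltr_pdivrMr //.
  by have := floorD1_gt lg; rewrite EL addrC -intS.
have : (dynamic_chromatic_number G <= (chromatic_number G + L.+1 * r).+1)%N.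
  by apply: dynamic_chromatic_bound => //; rewrite -hdelta.
lia.
Qed.
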